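(* Let $(M,\omega)$ be a closed symplectic manifold, let $J_0$ be a positive associated almost complex structure on $M$ and $g_0$ the associated metric corresponding to $J_0$. An almost complex structure $J$ on $M$ is positive associated if and only if it is represented as $J=J_0(1+P)(1-P)^{-1}$, where the endomorphism $P:TM\to TM$ has the properties: 1) $PJ_0=-J_0P$; 2) $P$ is symmetric with respect to $g_0$; 3) $1-P^2$ is positive with respect to $g_0$.
   Context: An almost complex structure $J$ ($J^2=-I$) on $M$ is positive associated (with $\omega$) if $\omega(JX,JY)=\omega(X,Y)$ for all vector fields $X,Y$ and $\omega(X,JX)>0$ for $X\neq0$. The associated metric corresponding to it is $g(X,Y)=\omega(X,JY)$; so $g_0(X,Y)=\omega(X,J_0Y)$. $1$ is the identity of $TM$. An operator $S$ is positive with respect to $g_0$ if $g_0(X,SX)>0$ for $X\ne0$; for symmetric $P$ with $1-P^2$ positive, $1-P$ is invertible. *)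

(* Defs.v *)
From HB Require Import structures.
From mathcomp Require Import all_boot all_order all_algebra.
From mathcomp Require Import boolp classical_sets functions reals topology.
From mathcomp Require Import normedtype derive.

Set Implicit Arguments.
Unset Strict Implicit.
Unset Printing Implicit Defensive.

Import Order.TTheory GRing.Theory Num.Theory.
Import numFieldNormedType.Exports.

Local Open Scope classical_set_scope.
Local Open Scope ring_scope.

(* Meant for open A, where f being differentiable at a point of A does not
   depend on the values of f outside A. *)
Fixpoint Ck_on (R : realType) (V W : normedModType R) (k : nat) (A : set V)
    (f : V -> W) : Prop :=
  match k with
  | 0%N => forall x, A x -> {for x, continuous f}
  | k'.+1 => (forall x, A x -> differentiable f x) /\
             (forall v, Ck_on k' A (fun x => 'D_v f x))
  end.

Definition smooth_on (R : realType) (V W : normedModType R) (A : set V)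
    (f : V -> W) : Prop :=
  forall k, Ck_on k A f.

(* A homeomorphism between an open subset of M and an open subset of R^n; the
   values of chart_map outside chart_dom, and those of chart_inv outside the
   image of chart_dom, are irrelevant. *)
Record chart (R : realType) (n : nat) (M : topologicalType) := Chart {
  chart_dom : set M;
  chart_map :> M -> 'rV[R]_n;
  chart_inv : 'rV[R]_n -> M;
  chart_dom_open : open chart_dom;
  chart_img_open : open (chart_map @` chart_dom);
  chart_mapK : forall x, chart_dom x -> chart_inv (chart_map x) = x;
  chart_map_cont : forall x, chart_dom x -> {for x, continuous chart_map};
  chart_inv_cont : forall u, (chart_map @` chart_dom) u ->
    {for u, continuous chart_inv}
}.

Definition chart_img (R : realType) (n : nat) (M : topologicalType)
    (c : chart R n M) : set 'rV[R]_n :=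
  c @` chart_dom c.

(* The change of coordinates from c to d. *)
Definition transition (R : realType) (n : nat) (M : topologicalType)
    (c d : chart R n M) : 'rV[R]_n -> 'rV[R]_n :=
  d \o chart_inv c.

(* The atlas need not be maximal: an atlas and the maximal atlas containing it
   define the same tangent spaces and the same smooth tensor fields. *)
Record smoothManifold (R : realType) (n : nat) := SmoothManifold {
  carrier :> topologicalType;
  atlas_index : Type;
  atlas : atlas_index -> chart R n carrier;
  manifold_hausdorff : hausdorff_space carrier;
  manifold_second_countable : @second_countable carrier;
  atlas_cover : forall x, exists i, chart_dom (atlas i) x;
  atlas_smooth : forall i j,
    smooth_on (atlas i @` (chart_dom (atlas i) `&` chart_dom (atlas j)))
      (transition (atlas i) (atlas j))
}.

Lemma diff_chain (R : realType) (U V W : normedModType R) (f : U -> V)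
    (g : V -> W) (h : U -> W) (a e : U) (b : V) : f a = b ->
  differentiable f a -> differentiable g b -> differentiable h a ->
  (\near a, g (f a) = h a) -> 'd h a e = 'd g b ('d f a e).
Proof.
move=> <- df dg dh gfh.
have dgf := congr1 (fun k => k e) (diff_comp df dg); rewrite /= in dgf.
rewrite -dgf -(deriveE _ dh) -(deriveE _ (differentiable_comp df dg)).
by apply: near_eq_derive; near do apply/esym.
Unshelve. all: by end_near. Qed.

Lemma diff_trans_id (R : realType) (n : nat) (M : smoothManifold R n)
    (i : atlas_index M) (x : M) (e : 'rV[R]_n) : chart_dom (atlas i) x ->
  'd (transition (atlas i) (atlas i)) (atlas i x) e = e.
Proof.
move=> xi.
have dii : differentiable (transition (atlas i) (atlas i)) (atlas i x).
  by have [+ _] := @atlas_smooth _ _ M i i 1; apply; exists x.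
rewrite -deriveE // (@near_eq_derive _ _ _ _ id) ?derive_id //.
near=> u; have [y yi <-] : chart_img (atlas i) u.
  near: u; apply: open_nbhs_nbhs; split; first exact: chart_img_open.
  by exists x.
by rewrite /transition /= chart_mapK.
Unshelve. all: by end_near. Qed.

Lemma diff_trans_comp (R : realType) (n : nat) (M : smoothManifold R n)
    (i j k : atlas_index M) (x : M) (e : 'rV[R]_n) :
  chart_dom (atlas i) x -> chart_dom (atlas j) x -> chart_dom (atlas k) x ->
  'd (transition (atlas i) (atlas k)) (atlas i x) e =
  'd (transition (atlas j) (atlas k)) (atlas j x)
    ('d (transition (atlas i) (atlas j)) (atlas i x) e).
Proof.
move=> xi xj xk.
have dtr a b : chart_dom (atlas a) x -> chart_dom (atlas b) x ->
    differentiable (transition (atlas a) (atlas b)) (atlas a x).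
  by move=> xa xb; have [+ _] := @atlas_smooth _ _ M a b 1; apply; exists x.
have tij : transition (atlas i) (atlas j) (atlas i x) = atlas j x.
  by rewrite /transition /= chart_mapK.
apply: (@diff_chain _ _ _ _ _ _ _ _ _ _ tij);
  [exact: dtr|exact: dtr|exact: dtr|].
near=> u.
rewrite /transition /= chart_mapK //.
near: u; apply: (@chart_inv_cont _ _ _ (atlas i)); first by exists x.
rewrite chart_mapK //; apply: open_nbhs_nbhs; split=> //.
exact: chart_dom_open.
Unshelve. all: by end_near. Qed.

Section TangentSpace.
Variables (R : realType) (n : nat) (M : smoothManifold R n) (x : M).
Local Notation I := (atlas_index M).
Local Notation dom i := (chart_dom (atlas (i : I))).
Local Notation trans i j := (transition (atlas (i : I)) (atlas (j : I))).

(* A tangent vector at x is given by its coordinates in all the charts around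
   x, related by the differentials of the changes of coordinates.  Components
   along the charts whose domain does not contain x carry no information and
   are set to 0. *)
Definition is_tangent (v : I -> 'rV[R]_n) : Prop :=
  (forall i j, dom i x -> dom j x -> v j = 'd (trans i j) (atlas i x) (v i)) /\
  (forall i, ~ dom i x -> v i = 0).

Definition tangent_pred : {pred I -> 'rV[R]_n} := fun v => `[< is_tangent v >].

Fact tangent_submod_closed : submod_closed tangent_pred.
Proof.
split=> [|a u v /asboolP[u1 u0] /asboolP[v1 v0]]; apply/asboolP; split=> //.
- by move=> i j _ _; rewrite linear0.
- by move=> i j xi xj; rewrite !fctE linearP -u1// -v1.
- by move=> i xi; rewrite !fctE u0// v0// scaler0 addr0.
Qed.

HB.instance Definition _ :=
  GRing.isSubmodClosed.Build R (I -> 'rV[R]_n) tangent_pred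
    tangent_submod_closed.

Record tangent := Tangent {
  tcoord : I -> 'rV[R]_n;
  tangentP : tcoord \in tangent_pred
}.

HB.instance Definition _ := [isSub for tcoord].
HB.instance Definition _ := [Choice of tangent by <:].
HB.instance Definition _ := [SubChoice_isSubLmodule of tangent by <:].

Definition tvec_coord (i : I) (e : 'rV[R]_n) : I -> 'rV[R]_n := fun j =>
  if pselect (dom i x /\ dom j x) then 'd (trans i j) (atlas i x) e else 0.

Fact tvec_subproof (i : I) (e : 'rV[R]_n) : tvec_coord i e \in tangent_pred.
Proof.
apply/asboolP; split=> [j k xj xk|j xj]; rewrite /tvec_coord.
  have [xi|nxi] := pselect (dom i x).
    do 2![case: pselect => [?|nx]; last by case: nx].
    exact: diff_trans_comp.
  case: pselect => [[]//|nxij]; case: pselect => [[]//|nxik] /=.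
  exact/esym/linear0.
by case: pselect => // -[].
Qed.

(* The tangent vector at x with coordinates e in the chart i, if x lies in the
   domain of this chart. *)
Definition tvec (i : I) (e : 'rV[R]_n) : tangent := Tangent (tvec_subproof i e).

Lemma tcoord_tvec (i : I) (e : 'rV[R]_n) : dom i x -> tcoord (tvec i e) i = e.
Proof.
move=> xi; rewrite /= /tvec_coord; case: pselect => [xii|nx]; last by case: nx.
exact: diff_trans_id.
Qed.

Lemma tvecK (i : I) (v : tangent) : dom i x -> tvec i (tcoord v i) = v.
Proof.
move=> xi; apply: val_inj => /=; apply/funext => j; rewrite /tvec_coord.
have /asboolP[v1 v0] := tangentP v.
case: pselect => [xij|nxij] /=; first by case: xij => _ xj; rewrite -v1.
by rewrite v0// => xj; exact: nxij.
Qed.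

Fact tangent_vect_axiom : Vector.axiom n tangent.
Proof.
have [i xi] := cid (atlas_cover x).
exists (fun v => tcoord v i) => [//|].
by exists (tvec i) => v; [exact: tvecK|exact: tcoord_tvec].
Qed.

HB.instance Definition _ := Lmodule_hasFinDim.Build R tangent tangent_vect_axiom.

End TangentSpace.

Section TensorFields.
Variables (R : realType) (n : nat) (M : smoothManifold R n).
Local Notation T x := (tangent x).
Local Notation e_ a := (delta_mx (0 : 'I_1) a : 'rV[R]_n).

Definition coord_vec (i : atlas_index M) (a : 'I_n) (x : M) : T x :=
  tvec x i (e_ a).

Definition endo_field := forall x : M, 'End(T x).

(* Row a holds the coordinates of the image of the a-th coordinate vector. *)
Definition endo_mx (A : endo_field) (i : atlas_index M) (u : 'rV[R]_n) :
    'M[R]_n :=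
  let x := chart_inv (atlas i) u in
  \matrix_(a, b) tcoord (A x (coord_vec i a x)) i 0 b.

Definition smooth_endo (A : endo_field) : Prop :=
  forall i, smooth_on (chart_img (atlas i)) (endo_mx A i).

Definition form2 := forall x : M, T x -> T x -> R.

Definition form2_mx (w : form2) (i : atlas_index M) (u : 'rV[R]_n) :
    'M[R]_n :=
  let x := chart_inv (atlas i) u in
  \matrix_(a, b) w x (coord_vec i a x) (coord_vec i b x).

Definition smooth_form2 (w : form2) : Prop :=
  forall i, smooth_on (chart_img (atlas i)) (form2_mx w i).

Definition bilinear_form2 (w : form2) : Prop :=
  forall x (k : R) (X Y Z : T x),
    w x (k *: X + Y) Z = k * w x X Z + w x Y Z /\
    w x Z (k *: X + Y) = k * w x Z X + w x Z Y.

Definition alternating_form2 (w : form2) : Prop :=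
  forall x (X : T x), w x X X = 0.

Definition nondegenerate_form2 (w : form2) : Prop :=
  forall x (X : T x), (forall Y : T x, w x X Y = 0) -> X = 0.

(* dw = 0: in local coordinates,
   (dw)_abc = d_a w_bc + d_b w_ca + d_c w_ab. *)
Definition closed_form2 (w : form2) : Prop :=
  forall i u, chart_img (atlas i) u -> forall a b c,
    'D_(e_ a) (fun u => form2_mx w i u b c : R^o) u +
    'D_(e_ b) (fun u => form2_mx w i u c a : R^o) u +
    'D_(e_ c) (fun u => form2_mx w i u a b : R^o) u = 0.

Definition symplectic_form (w : form2) : Prop :=
  [/\ bilinear_form2 w, alternating_form2 w, smooth_form2 w,
      nondegenerate_form2 w & closed_form2 w].

Definition almost_complex (J : endo_field) : Prop :=
  smooth_endo J /\ forall x, (J x \o J x)%VF = - \1%VF.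

Definition positive_associated (w : form2) (J : endo_field) : Prop :=
  (forall x (X Y : T x), w x (J x X) (J x Y) = w x X Y) /\
  (forall x (X : T x), X != 0 -> 0 < w x X (J x X)).

Definition associated_metric (w : form2) (J : endo_field) : form2 :=
  fun x X Y => w x X (J x Y).

Definition symmetric_wrt (g : form2) (S : endo_field) : Prop :=
  forall x (X Y : T x), g x (S x X) Y = g x X (S x Y).

Definition positive_wrt (g : form2) (S : endo_field) : Prop :=
  forall x (X : T x), X != 0 -> 0 < g x X (S x X).

End TensorFields.

Definition closed_manifold (R : realType) (n : nat) (M : smoothManifold R n) :
    Prop :=
  compact [set: M].

(* Main.v *)
Require Import Defs.
From HB Require Import structures.
From mathcomp Require Import all_boot all_order all_algebra.
From mathcomp Require Import boolp classical_sets functions reals topology.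
From mathcomp Require Import normedtype landau derive.

Set Implicit Arguments.
Unset Strict Implicit.
Unset Printing Implicit Defensive.

Import Order.TTheory GRing.Theory Num.Theory.
Import numFieldNormedType.Exports.

Local Open Scope classical_set_scope.
Local Open Scope ring_scope.

(** The equation J = J0 (1 + P) (1 - P)^-1 is a Cayley transform.  Written as
    J (1 - P) = J0 (1 + P), it reads (J + J0) P = J - J0, so the only candidate
    for P is (J + J0)^-1 (J - J0).

    At a point the statement is linear algebra.  Since P anticommutes with J0,
    being symmetric for g0 amounts to being skew for w ([skew_symmetricP]), and
    then
      w ((1 - P) X, J (1 - P) X) = g0 (X, (1 - P^2) X)
    ([cayley_metric]): because 1 - P is invertible, J is tamed by w exactly when
    1 - P^2 is positive.  For P skew, w is likewise unchanged when 1 + P is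
    replaced by 1 - P in both arguments, which makes J preserve w
    ([cayley_to_associated]).  Conversely, if J and J0 are both tamed by w, then
    so is J + J0, which is therefore invertible; the relations
    J (J + J0) = (J + J0) J0 and (J - J0) (J + J0) = - (J + J0) (J - J0) give
    the anticommutation and the skewness of P ([associated_to_cayley]).

    What is not pointwise is the smoothness of P.  In a chart, the matrix of P
    is the product of the matrix of J - J0 by the inverse of that of J + J0.
    By Cramer's rule its entries are rational functions, with nonvanishing
    denominators, of smooth functions, so a calculus of C^k functions stable
    under sums, products and inverses suffices ([smooth_on_invmx],
    [smooth_endo_inv]). *)

(** * Calculus of C^k functions on an open set *)

Section NearDifferentiable.
Variables (R : realType) (V W : normedModType R).

(** The differential is chosen by a global specification of the function, so
    locality has to go through its uniqueness: 'd f x also satisfies the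
    first-order expansion of g at x. *)
Lemma near_eq_differentiable (f g : V -> W) (x : V) : {near x, f =1 g} ->
  differentiable f x -> differentiable g x.
Proof.
move=> fg /diff_locallyP[cdf dfE].
have dgE : g \o shift x = cst (g x) + 'd f x +o_ 0 id.
  apply/eqaddoP => e e0; move/eqaddoP: dfE => /(_ e e0) fe.
  have fg0 : \forall h \near 0, f (h + x) = g (h + x).
    by move: fg; rewrite [X in X -> _](near_shift 0)/= subr0.
  have fgx := nbhs_singleton fg; near=> h.
  have <- : (f \o shift x - (cst (f x) + 'd f x)) h =
            (g \o shift x - (cst (g x) + 'd f x)) h.
    by rewrite !fctE /= fgx; congr (_ - _); near: h.
  by near: h.
apply/diff_locallyP; rewrite (diff_unique cdf dgE); split=> //.
Unshelve. all: by end_near. Qed.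

Lemma differentiable_linear_comp (W' : normedModType R) (l : {linear W -> W'})
    (f : V -> W) (x : V) : continuous l -> differentiable f x ->
  differentiable (l \o f) x.
Proof.
by move=> cl df; apply: differentiable_comp df _; exact: linear_differentiable.
Qed.

Lemma derive_linear_comp (W' : normedModType R) (l : {linear W -> W'})
    (f : V -> W) (x v : V) : continuous l -> differentiable f x ->
  'D_v (l \o f) x = l ('D_v f x).
Proof.
move=> cl df; have dl y := linear_differentiable y cl.
rewrite !deriveE//; last exact: differentiable_comp.
by rewrite diff_comp//= [X in X _ = _]diff_lin.
Qed.

End NearDifferentiable.

Section CkCalculus.
Variables (R : realType) (U : normedModType R) (A : set U).
Hypothesis openA : open A.
Implicit Types (V W : normedModType R) (k : nat).

(** This is where openness matters: [Ck_on] speaks of derivatives at the points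
    of [A], which depend on values in a whole neighborhood.  Every induction on
    the order of differentiation below passes through this lemma, since the
    formulas for 'D_v of a sum, product or inverse only hold at points of [A]. *)
Lemma Ck_on_eq V k (f g : U -> V) : (forall x, A x -> f x = g x) ->
  Ck_on k A f -> Ck_on k A g.
Proof.
have nfg (V' : normedModType R) (f' g' : U -> V') :
    (forall x, A x -> f' x = g' x) -> forall x, A x -> {near x, f' =1 g'}.
  move=> fg x Ax; near=> y; apply: fg.
  by near: y; exact: open_nbhs_nbhs.
elim: k f g => [|k IH] f g fg /=.
  move=> cf x Ax; rewrite /prop_for /continuous_at -fg//.
  exact: cvg_trans (near_eq_cvg (nfg _ _ _ fg _ Ax)) (cf x Ax).
move=> [df dvf]; split=> [x Ax|v].
  exact: near_eq_differentiable (nfg _ _ _ fg _ Ax) (df x Ax).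
by apply: IH (dvf v) => x Ax; apply: near_eq_derive; exact: nfg.
Unshelve. all: by end_near. Qed.

Lemma Ck_on_le V k (f : U -> V) : Ck_on k.+1 A f -> Ck_on k A f.
Proof.
elim: k f => [|k IH] f [df dvf].
  by move=> x Ax; exact: differentiable_continuous (df x Ax).
by split=> // v; exact: IH (dvf v).
Qed.

Lemma Ck_on_cst V k (c : V) : Ck_on k A (cst c : U -> V).
Proof.
elim: k c => [|k IH] c; first by move=> x _; exact: cvg_cst.
split=> [x _|v]; first exact: differentiable_cst.
by apply: Ck_on_eq (IH 0) => x _; rewrite derive_cst.
Qed.

Lemma Ck_onD V k (f g : U -> V) :
  Ck_on k A f -> Ck_on k A g -> Ck_on k A (f + g).
Proof.
elim: k f g => [|k IH] f g.
  by move=> cf cg x Ax; apply: continuousD; [exact: cf|exact: cg].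
move=> [df dvf] [dg dvg]; split=> [x Ax|v].
  by apply: differentiableD; [exact: df|exact: dg].
apply: Ck_on_eq (IH _ _ (dvf v) (dvg v)) => x Ax.
by rewrite deriveD//; apply: diff_derivable; [exact: df|exact: dg].
Qed.

Lemma Ck_on_linear V W k (l : {linear V -> W}) (f : U -> V) : continuous l ->
  Ck_on k A f -> Ck_on k A (l \o f).
Proof.
move=> cl; elim: k f => [|k IH] f.
  by move=> cf x Ax; apply: continuous_comp; [exact: cf|exact: cl].
move=> [df dvf]; split=> [x Ax|v].
  by apply: differentiable_linear_comp => //; exact: df.
apply: Ck_on_eq (IH _ (dvf v)) => x Ax.
by rewrite derive_linear_comp//; exact: df.
Qed.

Lemma Ck_onM k (f g : U -> R) :
  Ck_on k A f -> Ck_on k A g -> Ck_on k A (f * g).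
Proof.
elim: k f g => [|k IH] f g.
  by move=> cf cg x Ax; apply: continuousM; [exact: cf|exact: cg].
move=> Cf Cg; have [df dvf] := Cf; have [dg dvg] := Cg; split=> [x Ax|v].
  by apply: differentiableM; [exact: df|exact: dg].
have := Ck_onD (IH _ _ (Ck_on_le Cf) (dvg v)) (IH _ _ (Ck_on_le Cg) (dvf v)).
apply: Ck_on_eq => x Ax.
by rewrite deriveM//; apply: diff_derivable; [exact: df|exact: dg].
Qed.

(** The induction closes because the derivative of 1 / f is - (1 / f)^2 D f,
    where 1 / f is one order less regular than what is being proved. *)
Lemma Ck_onV k (f : U -> R) : (forall x, A x -> f x != 0) ->
  Ck_on k A f -> Ck_on k A (fun x => (f x)^-1).
Proof.
move=> f0; elim: k => [|k IH] Cf.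
  by move=> x Ax; apply: continuousV; [exact: f0|exact: Cf].
have [df dvf] := Cf; split=> [x Ax|v].
  by apply: differentiableV; [exact: df|exact: f0].
have CV := IH (Ck_on_le Cf).
have := Ck_onM (Ck_on_cst k (-1 : R)) (Ck_onM (Ck_onM CV CV) (dvf v)).
apply: Ck_on_eq => x Ax; rewrite deriveV//; [|exact: f0|].
  by rewrite !fctE mulN1r -expr2 exprVn scaleNr.
by apply: diff_derivable; exact: df.
Qed.

End CkCalculus.

(** * Smooth matrix-valued functions *)

Section SmoothMatrices.
Variables (R : realType) (U : normedModType R) (A : set U).
Hypothesis openA : open A.

Lemma smooth_on_eq (V : normedModType R) (f g : U -> V) :
  (forall x, A x -> f x = g x) -> smooth_on A f -> smooth_on A g.
Proof. by move=> fg sf k; exact: Ck_on_eq fg (sf k). Qed.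

Lemma smooth_onD (V : normedModType R) (f g : U -> V) :
  smooth_on A f -> smooth_on A g -> smooth_on A (fun x => f x + g x).
Proof. by move=> sf sg k; exact: Ck_onD (sf k) (sg k). Qed.

Lemma smooth_onM (f g : U -> R) :
  smooth_on A f -> smooth_on A g -> smooth_on A (fun x => f x * g x).
Proof. by move=> sf sg k; exact: Ck_onM (sf k) (sg k). Qed.

Lemma smooth_on_sum (V : normedModType R) (I : Type) (r : seq I)
    (F : I -> U -> V) : (forall i, smooth_on A (F i)) ->
  smooth_on A (fun x => \sum_(i <- r) F i x).
Proof.
move=> sF; elim: r => [|i r IH].
  by apply: (@smooth_on_eq _ (cst 0)) => [x _|k];
    [rewrite big_nil|exact: Ck_on_cst].
apply: smooth_on_eq (smooth_onD (sF i) IH) => x _.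
by rewrite big_cons.
Qed.

Lemma smooth_on_prod (I : Type) (r : seq I) (F : I -> U -> R) :
  (forall i, smooth_on A (F i)) -> smooth_on A (fun x => \prod_(i <- r) F i x).
Proof.
move=> sF; elim: r => [|i r IH].
  by apply: (@smooth_on_eq _ (cst (1 : R))) => [x _|k];
    [rewrite big_nil|exact: Ck_on_cst].
apply: smooth_on_eq (smooth_onM (sF i) IH) => x _.
by rewrite big_cons.
Qed.

(** Entries are continuous linear images of the matrix, and the matrix is the
    sum of the continuous linear images a *: E_ij of its entries a. *)
Lemma smooth_on_mxP m n (F : U -> 'M[R]_(m, n)) :
  smooth_on A F <-> forall i j, smooth_on A (fun x => F x i j).
Proof.
split=> [sF i j k|sF].
  have coord_lin : linear (fun N : 'M[R]_(m, n) => N i j).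
    by move=> c M N; rewrite !mxE.
  pose coordM := GRing.isLinear.Build _ _ _ _ _ coord_lin.
  pose coordL : {linear 'M[R]_(m, n) -> R} :=
    HB.pack (fun N : 'M[R]_(m, n) => N i j) coordM.
  apply: (@Ck_on_linear _ _ _ openA _ _ k coordL) (sF k).
  exact: coord_continuous.
have sD i j : smooth_on A (fun x => F x i j *: delta_mx i j : 'M[R]_(m, n)).
  move=> k.
  have scale_lin : linear (fun a : R => a *: (delta_mx i j : 'M[R]_(m, n))).
    by move=> c a b; rewrite scalerDl scalerA.
  pose scaleM := GRing.isLinear.Build _ _ _ _ _ scale_lin.
  pose scaleL : {linear R -> 'M[R]_(m, n)} :=
    HB.pack (fun a : R => a *: (delta_mx i j : 'M[R]_(m, n))) scaleM.
  apply: (@Ck_on_linear _ _ _ openA _ _ k scaleL) (sF i j k).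
  exact: scalel_continuous.
apply: smooth_on_eq (smooth_on_sum _ (fun i => smooth_on_sum _ (sD i))).
by move=> x _; rewrite [RHS]matrix_sum_delta.
Qed.

Lemma smooth_on_mulmx m n p (F : U -> 'M[R]_(m, n)) (G : U -> 'M[R]_(n, p)) :
  smooth_on A F -> smooth_on A G -> smooth_on A (fun x => F x *m G x).
Proof.
move=> /smooth_on_mxP sF /smooth_on_mxP sG; apply/smooth_on_mxP => i j.
apply: smooth_on_eq (smooth_on_sum _ (fun l => smooth_onM (sF i l) (sG l j))).
by move=> x _; rewrite mxE.
Qed.

Lemma smooth_on_det n (F : U -> 'M[R]_n) : smooth_on A F ->
  smooth_on A (fun x => \det (F x)).
Proof.
move=> /smooth_on_mxP sF; apply: smooth_on_sum => s; apply: smooth_onM.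
  by move=> k; exact: Ck_on_cst.
by apply: smooth_on_prod => i; exact: sF.
Qed.

(** Cramer's rule: the inverse is the adjugate, polynomial in the entries,
    divided by the determinant. *)
Lemma smooth_on_invmx n (F : U -> 'M[R]_n) :
  (forall x, A x -> F x \in unitmx) -> smooth_on A F ->
  smooth_on A (fun x => invmx (F x)).
Proof.
move=> uF sF; have sF' := (smooth_on_mxP F).1 sF; apply/smooth_on_mxP => i j.
have sdetV : smooth_on A (fun x => (\det (F x))^-1).
  move=> k; apply: Ck_onV => [//|x Ax|]; last exact: smooth_on_det.
  by rewrite -unitfE -unitmxE uF.
have scof : smooth_on A (fun x => cofactor (F x) j i).
  apply: smooth_onM; first by move=> k; exact: Ck_on_cst.
  apply: smooth_on_det; apply/smooth_on_mxP => a b.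
  apply: smooth_on_eq (sF' (lift j a) (lift i b)) => x _.
  by rewrite !mxE.
apply: smooth_on_eq (smooth_onM sdetV scof) => x Ax.
by rewrite /invmx uF// !mxE.
Qed.

End SmoothMatrices.

(** * Smooth fields of endomorphisms *)

Section EndoFields.
Variables (R : realType) (n : nat) (M : smoothManifold R n).
Implicit Types (A B : endo_field M) (i : atlas_index M).

Lemma chart_inv_dom i u : chart_img (atlas i) u ->
  chart_dom (atlas i) (chart_inv (atlas i) u).
Proof. by move=> [x xi <-]; rewrite chart_mapK. Qed.

Lemma tcoord_sum (x : M) i (I : Type) (r : seq I) (F : I -> tangent x) :
  tcoord (\sum_(a <- r) F a) i = \sum_(a <- r) tcoord (F a) i.
Proof. by elim/big_rec2: _ => [//|a v e _ <-]. Qed.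

Lemma tcoord_inj (x : M) i (v v' : tangent x) : chart_dom (atlas i) x ->
  tcoord v i = tcoord v' i -> v = v'.
Proof. by move=> xi vv'; rewrite -(tvecK v xi) vv' tvecK. Qed.

Lemma tangent_coord_sum (x : M) i (v : tangent x) : chart_dom (atlas i) x ->
  v = \sum_a tcoord v i 0 a *: coord_vec i a x.
Proof.
move=> xi; apply: (tcoord_inj xi); rewrite tcoord_sum.
rewrite {1}[tcoord v i]row_sum_delta; apply: eq_bigr => a _.
by rewrite -[RHS]/(_ *: tcoord (coord_vec i a x) i) tcoord_tvec.
Qed.

(** Coordinates are row vectors, so endomorphisms act by right multiplication
    and composition reverses the order of matrices in [endo_mx_comp]. *)
Lemma tcoord_endo A i u (v : tangent (chart_inv (atlas i) u)) :
  chart_img (atlas i) u -> tcoord (A _ v) i = tcoord v i *m endo_mx A i u.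
Proof.
move=> iu; have xi := chart_inv_dom iu.
rewrite {1}(tangent_coord_sum v xi) linear_sum tcoord_sum.
apply/rowP => b; rewrite summxE mxE; apply: eq_bigr => a _.
by rewrite linearZ /= !mxE.
Qed.

Lemma endo_mx_row A i u (E : 'M[R]_n) : chart_img (atlas i) u ->
  (forall v : tangent (chart_inv (atlas i) u),
    tcoord (A _ v) i = tcoord v i *m E) ->
  endo_mx A i u = E.
Proof.
move=> iu AE; apply/matrixP => a b; rewrite mxE AE tcoord_tvec.
  by rewrite -rowE mxE.
exact: chart_inv_dom.
Qed.

Lemma endo_mx_comp A B i u : chart_img (atlas i) u ->
  endo_mx (fun x => A x \o B x)%VF i u = endo_mx B i u *m endo_mx A i u.
Proof.
move=> iu; apply: endo_mx_row => // v.
by rewrite comp_lfunE !tcoord_endo// mulmxA.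
Qed.

Lemma endo_mx1 i u : chart_img (atlas i) u ->
  endo_mx (fun x : M => \1%VF) i u = 1%:M.
Proof. by move=> iu; apply: endo_mx_row => // v; rewrite id_lfunE mulmx1. Qed.

Lemma smooth_endo_lin (a : R) A B : smooth_endo A -> smooth_endo B ->
  smooth_endo (fun x => a *: A x + B x).
Proof.
move=> sA sB i; have oi : open (chart_img (atlas i)) by exact: chart_img_open.
have sAi := (smooth_on_mxP oi _).1 (sA i).
have sBi := (smooth_on_mxP oi _).1 (sB i).
apply/smooth_on_mxP => // b c.
have sa : smooth_on (chart_img (atlas i)) (cst a : 'rV[R]_n -> R).
  by move=> k; exact: Ck_on_cst.
apply: smooth_on_eq (smooth_onD oi (smooth_onM oi sa (sAi b c)) (sBi b c)) => //.
by move=> u iu; rewrite !mxE add_lfunE scale_lfunE /= !mxE.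
Qed.

Lemma smooth_endo_comp A B : smooth_endo A -> smooth_endo B ->
  smooth_endo (fun x => A x \o B x)%VF.
Proof.
move=> sA sB i; have oi : open (chart_img (atlas i)) by exact: chart_img_open.
apply: smooth_on_eq (smooth_on_mulmx oi (sB i) (sA i)) => // u iu.
by rewrite endo_mx_comp.
Qed.

Lemma smooth_endo_inv A : (forall x, lker (A x) == 0%VS) -> smooth_endo A ->
  smooth_endo (fun x => (A x)^-1)%VF.
Proof.
move=> kA sA i; have oi : open (chart_img (atlas i)) by exact: chart_img_open.
have AV u : chart_img (atlas i) u ->
    endo_mx A i u *m endo_mx (fun x => (A x)^-1)%VF i u = 1%:M.
  move=> iu; rewrite -endo_mx_comp// -(endo_mx1 iu).
  congr endo_mx; apply: functional_extensionality_dep => x.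
  by rewrite lker0_compVf.
have uA u : chart_img (atlas i) u -> endo_mx A i u \in unitmx.
  by move=> /AV/mulmx1_unit[].
apply: smooth_on_eq (smooth_on_invmx oi uA (sA i)) => // u iu.
by rewrite -[RHS](mulKmx (uA u iu)) AV// mulmx1.
Qed.

End EndoFields.

(** * The Cayley transform at a point *)

Section LinearAlgebra.
Variables (R : realFieldType) (V : vectType R) (w : V -> V -> R).
Hypothesis bilin_w : forall (k : R) (X Y Z : V),
  w (k *: X + Y) Z = k * w X Z + w Y Z /\ w Z (k *: X + Y) = k * w Z X + w Z Y.
Implicit Types (X Y : V) (J P S : 'End(V)).

Let wDl X Y Z : w (X + Y) Z = w X Z + w Y Z.
Proof. by have [+ _] := bilin_w 1 X Y Z; rewrite scale1r mul1r. Qed.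

Let wDr X Y Z : w Z (X + Y) = w Z X + w Z Y.
Proof. by have [_ +] := bilin_w 1 X Y Z; rewrite scale1r mul1r. Qed.

Let w0r Z : w Z 0 = 0.
Proof. by apply: (addrI (w Z 0)); rewrite -wDr !addr0. Qed.

Let wNl X Z : w (- X) Z = - w X Z.
Proof.
have w0l : w 0 Z = 0 by apply: (addrI (w 0 Z)); rewrite -wDl !addr0.
by apply: (addrI (w X Z)); rewrite -wDl !subrr w0l.
Qed.

Let wNr X Z : w Z (- X) = - w Z X.
Proof. by apply: (addrI (w Z X)); rewrite -wDr !subrr w0r. Qed.

Definition invariant_wrt J := forall X Y, w (J X) (J Y) = w X Y.
Definition tamed_by J := forall X, X != 0 -> 0 < w X (J X).
Definition skew_wrt S := forall X Y, w (S X) Y = - w X (S Y).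

Lemma lker0_trivial S : (forall X, S X = 0 -> X = 0) -> lker S == 0%VS.
Proof.
move=> S0; apply/lker0P => X Y SXY; apply/eqP; rewrite -subr_eq0; apply/eqP.
by apply: S0; rewrite linearB /= SXY subrr.
Qed.

Lemma lker0_tamed S : tamed_by S -> lker S == 0%VS.
Proof.
move=> tS; apply: lker0_trivial => X SX; apply/eqP/negPn/negP => /tS.
by rewrite SX w0r ltxx.
Qed.

Section Cayley.
Variables (J0 J : 'End(V)).
Hypothesis J0K : forall X, J0 (J0 X) = - X.

(** The right-hand side is symmetry for the metric g0 (X, Y) = w (X, J0 Y).  As
    J0 is onto, skewness of P can be tested on vectors J0 Y, and there moving P
    across J0 changes the sign. *)
Lemma skew_symmetricP P : (forall X, P (J0 X) = - J0 (P X)) ->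
  skew_wrt P <-> (forall X Y, w (P X) (J0 Y) = w X (J0 (P Y))).
Proof.
move=> PJ0; split=> sP X Y; first by rewrite sP PJ0 wNr opprK.
by have := sP X (- J0 Y); rewrite linearN /= J0K opprK linearN /= linearN /= PJ0
  linearN /= J0K opprK wNr => <-.
Qed.

Lemma cayley_formulaP P : lker (\1 - P)%VF == 0%VS ->
  J = (J0 \o ((\1 + P) \o (\1 - P)^-1))%VF <->
  (forall X, J (X - P X) = J0 (X + P X)).
Proof.
move=> kP; split=> [-> X|JP].
  have -> : X - P X = (\1 - P)%VF X by rewrite !lfun_simp.
  by rewrite !comp_lfunE lker0_lfunK// add_lfunE id_lfunE.
apply/lfunP => X; rewrite !comp_lfunE.
have := JP ((\1 - P)^-1 X)%VF.
have {1}-> : forall Y, Y - P Y = (\1 - P)%VF Y.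
  by move=> Y; rewrite !lfun_simp.
by rewrite lker0_lfunVK// add_lfunE id_lfunE.
Qed.

(** By skewness 1 - P moves to the second argument as 1 + P, and
    (1 + P) J0 (1 + P) = J0 (1 - P) (1 + P) by anticommutation. *)
Lemma cayley_metric P : (forall X, P (J0 X) = - J0 (P X)) -> skew_wrt P ->
  (forall X, J (X - P X) = J0 (X + P X)) ->
  forall X, w (X - P X) (J (X - P X)) = w X (J0 (X - P (P X))).
Proof.
move=> PJ0 sP JP X.
rewrite JP wDl wNl sP opprK -wDr; congr (w X _).
by rewrite PJ0 linearB !linearD /= addrA addrK.
Qed.

(** Positivity makes 1 - P injective: P X = X gives (1 - P^2) X = 0.  Every
    vector is then some (1 - P) X, whose image under J is J0 (1 + P) X. *)
Lemma cayley_to_associated P :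
  (forall X, P (J0 X) = - J0 (P X)) -> skew_wrt P -> invariant_wrt J0 ->
  (forall X, X != 0 -> 0 < w X (J0 (X - P (P X)))) ->
  J = (J0 \o ((\1 + P) \o (\1 - P)^-1))%VF ->
  invariant_wrt J /\ tamed_by J.
Proof.
move=> PJ0 sP iJ0 pP JE.
have kP : lker (\1 - P)%VF == 0%VS.
  apply: lker0_trivial => X; rewrite !lfun_simp => /subr0_eq XP.
  apply/eqP/negPn/negP => /pP.
  by rewrite -!XP subrr linear0 w0r ltxx.
have JP := (cayley_formulaP kP).1 JE.
have surj X : exists Y, X = Y - P Y.
  exists ((\1 - P)^-1 X)%VF; rewrite -[LHS](lker0_lfunVK kP).
  by rewrite !lfun_simp.
split=> [X' Y'|X'].
  have [X ->] := surj X'; have [Y ->] := surj Y'.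
  rewrite !JP iJ0 !(wDl, wNl) !sP opprK -wNr -!wDr linearD linearB /=.
  by rewrite opprD addrA addrK addrA subrK.
have [X ->] := surj X' => X0; rewrite cayley_metric//; apply: pP.
by apply: contra_neq X0 => ->; rewrite linear0 subr0.
Qed.

(** As w (X, (J + J0) X) is a sum of two positive terms, J + J0 is invertible:
    (J + J0) P = J - J0 determines P.  Anticommutation is checked after applying
    J + J0, and skewness on vectors of the form (J + J0) X. *)
Lemma associated_to_cayley : (forall X, J (J X) = - X) ->
  invariant_wrt J0 -> tamed_by J0 -> invariant_wrt J -> tamed_by J ->
  let P := ((J + J0)^-1 \o (J - J0))%VF in
  [/\ lker (J + J0)%VF == 0%VS,
      J = (J0 \o ((\1 + P) \o (\1 - P)^-1))%VF,
      (forall X, P (J0 X) = - J0 (P X)),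
      skew_wrt P &
      (forall X, X != 0 -> 0 < w X (J0 (X - P (P X))))].
Proof.
move=> JK iJ0 tJ0 iJ tJ P.
have kA : lker (J + J0)%VF == 0%VS.
  by apply: lker0_tamed => X X0; rewrite lfun_simp wDr addr_gt0 ?tJ ?tJ0.
have AP X : J (P X) + J0 (P X) = J X - J0 X.
  have := lker0_lfunVK kA ((J - J0)%VF X).
  by rewrite -comp_lfunE -/P !lfun_simp.
clearbody P.
have Ainj X Y : J X + J0 X = J Y + J0 Y -> X = Y.
  by move=> XY; apply: (lker0P kA); rewrite !lfun_simp.
have JP X : J (X - P X) = J0 (X + P X).
  rewrite linearB linearD /=; apply/eqP; rewrite subr_eq -addrA addrC.
  by rewrite -subr_eq [J0 _ + _]addrC AP.
have kP : lker (\1 - P)%VF == 0%VS.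
  apply: lker0_trivial => X; rewrite !lfun_simp => /subr0_eq XP.
  have := JP X; rewrite -XP subrr linear0 => /esym/(congr1 J0).
  rewrite J0K linear0 => /eqP; rewrite oppr_eq0 -mulr2n -scaler_nat scaler_eq0.
  by rewrite pnatr_eq0 /= => /eqP.
(* Uses J (J + J0) = (J + J0) J0, a consequence of J^2 = J0^2 = -1. *)
have PJ0 X : P (J0 X) = - J0 (P X).
  have := congr1 J (AP X); rewrite linearD linearB /= !JK => E.
  apply: Ainj; rewrite AP !linearN /= !J0K !opprK.
  by apply: oppr_inj; rewrite !opprD opprK addrC [RHS]addrC E.
(* J + J0 and J - J0 anticommute, so P, defined by (J + J0) P = J - J0, also
   satisfies P (J + J0) = - (J - J0); this gives P on every vector of the form
   (J + J0) X without an inverse. *)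
have PA X : P (J X + J0 X) = - (J X - J0 X).
  apply: Ainj; rewrite AP !(linearN, linearD) /= !JK !J0K.
  rewrite !opprK [- X + _]addrC addrACA addNr addr0.
  by rewrite [X + _]addrC [RHS]addrACA subrr addr0.
have sP : skew_wrt P.
  move=> X' Y'.
  have surj Z : exists Y, Z = J Y + J0 Y.
    by exists ((J + J0)^-1 Z)%VF; rewrite -[LHS](lker0_lfunVK kA) lfun_simp.
  have [X ->] := surj X'; have [Y ->] := surj Y'.
  rewrite !PA !(wDl, wDr, wNl, wNr) iJ iJ0 opprK opprB addrACA -opprD.
  by rewrite [w X Y + w (J X) _]addrC [w X Y + _]addrC.
split=> //; first exact/cayley_formulaP.
move=> X X0; rewrite -(cayley_metric PJ0 sP JP); apply: tJ.
apply: contra_neq X0 => PX0.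
by apply: (lker0P kP); rewrite linear0 !lfun_simp.
Qed.

End Cayley.
End LinearAlgebra.

(** * Associated almost complex structures *)

Theorem proposition3p3 (R : realType) (n : nat) (M : smoothManifold R n)
    (closedM : closed_manifold M)
    (w : form2 M) (symplectic_w : symplectic_form w)
    (J0 : endo_field M) (acJ0 : almost_complex J0)
    (paJ0 : positive_associated w J0)
    (J : endo_field M) (acJ : almost_complex J) :
  positive_associated w J <->
  exists P : endo_field M,
    [/\ smooth_endo P,
        (forall x, J x = J0 x \o ((\1 + P x) \o (\1 - P x)^-1))%VF,
        (forall x, P x \o J0 x = - (J0 x \o P x))%VF,
        symmetric_wrt (associated_metric w J0) P &
        positive_wrt (associated_metric w J0)
          (fun x => \1 - (P x \o P x))%VF].
Proof.
have [bil_w _ _ _ _] := symplectic_w.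
have [sJ0 J0E] := acJ0; have [sJ JE] := acJ; have [iJ0 tJ0] := paJ0.
have sqr_lfun (K : endo_field M) : (forall x, (K x \o K x)%VF = - \1%VF) ->
    forall x X, K x (K x X) = - X.
  by move=> KE x X; rewrite -comp_lfunE KE !lfun_simp.
have J0K := sqr_lfun _ J0E; have JK := sqr_lfun _ JE.
split=> [[iJ tJ]|[P [sP JP PJ0 symP posP]]].
  have cay x := associated_to_cayley (bil_w x) (J0K x) (JK x)
    (iJ0 x) (@tJ0 x) (iJ x) (@tJ x).
  exists (fun x => ((J x + J0 x)^-1 \o (J x - J0 x))%VF).
  split=> [|x|x|x X Y|x X X0].
  - apply: smooth_endo_comp.
      apply: smooth_endo_inv => [x|]; first by have [] := cay x.
      have -> : (fun x => J x + J0 x) = (fun x => 1 *: J x + J0 x).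
        by apply: functional_extensionality_dep => x; rewrite scale1r.
      exact: smooth_endo_lin.
    have -> : (fun x => J x - J0 x) = (fun x => -1 *: J0 x + J x).
      by apply: functional_extensionality_dep => x; rewrite scaleN1r addrC.
    exact: smooth_endo_lin.
  - by have [] := cay x.
  - have [_ _ PJ0 _ _] := cay x; apply/lfunP => X.
    by rewrite opp_lfunE (comp_lfunE _ (J0 x)) (comp_lfunE (J0 x)) PJ0.
  - have [_ _ PJ0 skP _] := cay x.
    exact: ((skew_symmetricP (bil_w x) (J0K x) PJ0).1 skP).
  - have [_ _ _ _ posP] := cay x; have := posP X X0.
    by rewrite /associated_metric !lfun_simp.
have PJ0' x X : P x (J0 x X) = - J0 x (P x X).
  by rewrite -comp_lfunE PJ0 opp_lfunE comp_lfunE.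
have toJ x : invariant_wrt (@w x) (J x) /\ tamed_by (@w x) (J x).
  apply: (cayley_to_associated (bil_w x) (PJ0' x) _ (iJ0 x) _ (JP x)).
    exact/(skew_symmetricP (bil_w x) (J0K x) (PJ0' x)).2/symP.
  by move=> X /posP; rewrite /associated_metric !lfun_simp.
by split=> x; [have [] := toJ x|have [_] := toJ x; exact].
Qed.
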